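(* Let $a_{0},b_{0}\in\mathbb R$ with $a_{0}<b_{0}$, and let $\ell,r,q\in\overline{\mathbb N}_0$ be such that $\ell,r\le q$ and $\ell,r<\infty$. Let $\xi(x)=(x-a_{0})/(b_{0}-a_{0})$, and for $a_0\le x\le b_0$ define $$\mathcal{B}_{L}(g)(x)=\sum_{k=0}^{r}\frac{g^{(k)}(b_{0})}{k!}(x-b_{0})^{k}B_{\ell,r-k}(\xi(x)),\qquad \forall g\in C^{q}[a_{0},b_{0}],$$ $$\mathcal{B}_{R}(f)(x)=\sum_{j=0}^{\ell}\frac{f^{(j)}(a_{0})}{j!}(x-a_{0})^{j}B_{r,\ell-j}(1-\xi(x)),\qquad \forall f\in C^{q}[a_{0},b_{0}].$$ Then $\mathcal{B}_{L}$ is a linear leftward blend-to-zero operator from $C^{q}[a_{0},b_{0}]$ to itself of orders $\ell$ and $r$, and $\mathcal{B}_{R}$ is a linear rightward blend-to-zero operator from $C^{q}[a_{0},b_{0}]$ to itself of the same orders $\ell$ and $r$.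
   Context: $\overline{\mathbb N}_0=\{0,1,2,\dots\}\cup\{\infty\}$. $C^q[a_0,b_0]$ denotes the real-valued $q$-times continuously differentiable functions on $[a_0,b_0]$ (one-sided derivatives at endpoints). For non-negative integers $\ell,r$, the regularized incomplete Beta-function is $B_{\ell,r}(x)=\int_{0}^{x}t^{\ell}(1-t)^{r}dt\big/\int_{0}^{1}t^{\ell}(1-t)^{r}dt$ for $0\le x\le 1$. An operator $\mathcal{B}:C^{q}[a_{0},b_{0}]\to C^{q}[a_{0},b_{0}]$ is a rightward blend-to-zero operator of orders $\ell$ and $r$ (with $\ell,r\le q$) if for all $f\in C^{q}[a_{0},b_{0}]$ the function $f_0=\mathcal{B}(f)$ satisfies $f_0^{(j)}(a_0)=f^{(j)}(a_0)$ for $j=0,\dots,\ell$ and $f_0^{(k)}(b_0)=0$ for $k=0,\dots,r$. It is a leftward blend-to-zero operator of orders $\ell$ and $r$ if for all $g\in C^{q}[a_{0},b_{0}]$ the function $g_0=\mathcal{B}(g)$ satisfies $g_0^{(j)}(a_0)=0$ for $j=0,\dots,\ell$ and $g_0^{(k)}(b_0)=g^{(k)}(b_0)$ for $k=0,\dots,r$. *)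

(* Defs.v *)
From HB Require Import structures.
From mathcomp Require Import all_boot all_order all_algebra.
From mathcomp Require Import all_classical all_reals all_analysis.

Set Implicit Arguments.
Unset Strict Implicit.
Unset Printing Implicit Defensive.

Import Order.TTheory GRing.Theory Num.Theory.
Import numFieldNormedType.Exports.

Local Open Scope classical_set_scope.
Local Open Scope ring_scope.

(* Extended natural numbers: [None] stands for infinity. *)
Definition leq_ext (k : nat) (q : option nat) : bool :=
  if q is Some n then (k <= n)%N else true.

(* The interval as a type, carrying the subtype topology: neighbourhoods at an
   endpoint are therefore one-sided. *)
Notation itvcc a b := (set_type `[a, b]%classic).

Section Endpoints.
Context {R : realType} {a b : R} (hab : a < b).

Lemma lend_subproof : a \in `[a, b]%classic.
Proof. by rewrite inE /= in_itv /= lexx ltW. Qed.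

Lemma rend_subproof : b \in `[a, b]%classic.
Proof. by rewrite inE /= in_itv /= lexx ltW. Qed.

Definition lend : itvcc a b := exist _ a lend_subproof.
Definition rend : itvcc a b := exist _ b rend_subproof.

End Endpoints.

Section Derivatives.
Context {R : realType} {a b : R}.
Implicit Types (f : itvcc a b -> R) (x : itvcc a b).

(* Since [x^'] lives in the subtype, limits of slopes are two-sided at interior
   points and one-sided at [a] and [b]. *)
Definition slope f x : itvcc a b -> R :=
  fun y => (f y - f x) / (\val y - \val x).

Definition derivable_cc f : Prop :=
  forall x, cvg (slope f x y @[y --> x^']).

Definition deriv_cc f : itvcc a b -> R :=
  fun x => lim (slope f x y @[y --> x^']).

Definition derivn_cc (k : nat) f : itvcc a b -> R := iter k deriv_cc f.

Definition continuously_differentiable (q : option nat) f : Prop :=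
  (forall k, leq_ext k.+1 q -> derivable_cc (derivn_cc k f)) /\
  (forall k, leq_ext k q -> continuous (derivn_cc k f)).

End Derivatives.

(* [a < b] guarantees that no point of [a, b] is isolated, so that the limits
   above are unique and differentiation is linear. *)
Section Linearity.
Context {R : realType} {a b : R} (hab : a < b).
Implicit Types (f g : itvcc a b -> R) (x : itvcc a b).

Lemma dnbhs_cc_proper x : ProperFilter x^'.
Proof.
apply: Build_ProperFilter_ex => A xA.
have : nbhs x [set y | y != x -> A y] by exact: xA.
rewrite nbhsE /= => -[B [[C oC CB] Bx] BA].
have Cx : C (\val x) by move: Bx; rewrite -CB.
have /nbhs_ballP[e /= e0 eC] : nbhs (\val x) C by exact: open_nbhs_nbhs.
have xab : a <= \val x <= b by have := set_valP x; rewrite /= in_itv.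
have [y [yab yx ye]] :
    exists y, [/\ y \in `[a, b]%classic, y != \val x & `|\val x - y| < e].
  case/andP: xab => ax xb.
  have [xltb|bx] := ltP (\val x) b.
    pose d := Num.min (e / 2) (b - \val x).
    have d0 : 0 < d by rewrite /d lt_min divr_gt0 //= subr_gt0.
    exists (\val x + d); split.
    - rewrite inE /= in_itv /=; apply/andP; split.
        by rewrite (le_trans ax) // lerDl ltW.
      by rewrite -lerBrDl /d ge_min lexx orbT.
    - by rewrite gt_eqF // ltrDl.
    - rewrite opprD addrA subrr sub0r normrN gtr0_norm //.
      by rewrite /d gt_min ltr_pdivrMr // ltr_pMr // ltr1n.
  have xa : a < \val x by exact: lt_le_trans hab bx.
  pose d := Num.min (e / 2) (\val x - a).
  have d0 : 0 < d by rewrite /d lt_min divr_gt0 //= subr_gt0.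
  exists (\val x - d); split.
  - rewrite inE /= in_itv /=; apply/andP; split.
      by rewrite lerBrDr addrC -lerBrDr /d ge_min lexx orbT.
    by rewrite (le_trans _ xb) // gerBl ltW.
  - by rewrite lt_eqF // gtrBl.
  - rewrite opprB addrC subrK gtr0_norm //.
    by rewrite /d gt_min ltr_pdivrMr // ltr_pMr // ltr1n.
exists (exist _ y yab); apply: BA.
  by rewrite -CB /=; apply: eC.
by apply: contraNneq yx => <-.
Qed.

Lemma cvg_slope_lin (c : R) f g x : derivable_cc f -> derivable_cc g ->
  slope (c *: f + g) x y @[y --> x^'] --> c * deriv_cc f x + deriv_cc g x.
Proof.
move=> df dg.
have -> : slope (c *: f + g) x = (fun y => c * slope f x y + slope g x y).
  apply/funext => y; rewrite /slope /= mulrA -mulrDl; congr (_ / _).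
  by rewrite mulrBr addrACA -opprD.
by apply: cvgD; [apply: cvgMl_tmp; exact: df|exact: dg].
Qed.

Lemma deriv_cc_lin (c : R) f g : derivable_cc f -> derivable_cc g ->
  deriv_cc (c *: f + g) = c *: deriv_cc f + deriv_cc g.
Proof.
move=> df dg; apply/funext => x; rewrite /deriv_cc.
have xP := dnbhs_cc_proper x.
by apply: cvg_lim => //; exact: cvg_slope_lin.
Qed.

Lemma continuously_differentiable_lin q (c : R) f g :
  continuously_differentiable q f -> continuously_differentiable q g ->
  continuously_differentiable q (c *: f + g).
Proof.
move=> [df cf] [dg cg].
have DE k : leq_ext k q ->
    derivn_cc k (c *: f + g) = c *: derivn_cc k f + derivn_cc k g.
  elim: k => // k IH kq.
  have kq' : leq_ext k q by case: q kq {df cf dg cg IH} => //= n /ltnW.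
  rewrite /derivn_cc /= -/(derivn_cc _ _) IH //.
  by rewrite deriv_cc_lin; [|exact: df|exact: dg].
split=> k kq.
  have kq' : leq_ext k q by case: q kq {df cf dg cg DE} => //= n /ltnW.
  rewrite DE // => x; apply/cvg_ex; eexists.
  by apply: cvg_slope_lin; [exact: df|exact: dg].
rewrite DE // => x.
exact: (cvgD (cvgMl_tmp (cf k kq x)) (cg k kq x)).
Qed.

Lemma continuously_differentiable0 q :
  continuously_differentiable q (0 : itvcc a b -> R).
Proof.
have s0 x : slope (0 : itvcc a b -> R) x = (fun=> 0).
  by apply/funext => y; rewrite /slope subrr mul0r.
have D0 k : derivn_cc k (0 : itvcc a b -> R) = 0.
  elim: k => // k IH; rewrite /derivn_cc /= -/(derivn_cc _ _) IH.
  apply/funext => x; rewrite /deriv_cc s0; have xP := dnbhs_cc_proper x.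
  exact: (@lim_cst _ _ _ x^').
split=> k _ x; rewrite D0; last exact: (@cst_continuous _ _ 0).
by rewrite s0; exact: is_cvg_cst.
Qed.

End Linearity.

Section FunctionSpace.
Context {R : realType} {a b : R} (hab : a < b) (q : option nat).

(* The unused argument [a < b] lets the algebraic structure on [Cq hab q] be
   inferred; membership does not depend on it. *)
Definition Cq_pred (_ : a < b) : {pred itvcc a b -> R} :=
  fun f => `[< continuously_differentiable q f >].

Record Cq := MkCq { Cq_val :> itvcc a b -> R; _ : Cq_val \in Cq_pred hab }.

HB.instance Definition _ := [isSub for Cq_val].
HB.instance Definition _ := [Choice of Cq by <:].

Lemma Cq_submod_closed : submod_closed (Cq_pred hab).
Proof.
split=> [|c f g /asboolP Cf /asboolP Cg]; apply/asboolP.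
  exact: continuously_differentiable0.
exact: continuously_differentiable_lin.
Qed.

HB.instance Definition _ :=
  GRing.isSubmodClosed.Build R (itvcc a b -> R) (Cq_pred hab) Cq_submod_closed.
HB.instance Definition _ := [SubChoice_isSubLmodule of Cq by <:].

End FunctionSpace.

Arguments Cq {R a b} hab q.

(* Meant for 0 <= x <= 1. *)
Definition reg_inc_beta {R : realType} (l r : nat) (x : R) : R :=
  (\int[lebesgue_measure]_(t in `[0, x]) (t ^+ l * (1 - t) ^+ r)) /
  (\int[lebesgue_measure]_(t in `[0, 1]) (t ^+ l * (1 - t) ^+ r)).

Section Blending.
Context {R : realType} {a b : R} (hab : a < b) (q : option nat).

Definition leftward_blend (l r : nat) (B : Cq hab q -> Cq hab q) : Prop :=
  [/\ leq_ext l q, leq_ext r q &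
    forall g : Cq hab q,
      (forall j, (j <= l)%N -> derivn_cc j (B g) (lend hab) = 0) /\
      (forall k, (k <= r)%N ->
         derivn_cc k (B g) (rend hab) = derivn_cc k g (rend hab))].

Definition rightward_blend (l r : nat) (B : Cq hab q -> Cq hab q) : Prop :=
  [/\ leq_ext l q, leq_ext r q &
    forall f : Cq hab q,
      (forall j, (j <= l)%N ->
         derivn_cc j (B f) (lend hab) = derivn_cc j f (lend hab)) /\
      (forall k, (k <= r)%N -> derivn_cc k (B f) (rend hab) = 0)].

Definition xi (x : R) : R := (x - a) / (b - a).

Definition blendL (l r : nat) (g : itvcc a b -> R) (x : R) : R :=
  \sum_(0 <= k < r.+1) derivn_cc k g (rend hab) / k`!%:R * (x - b) ^+ k
    * reg_inc_beta l (r - k) (xi x).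

Definition blendR (l r : nat) (f : itvcc a b -> R) (x : R) : R :=
  \sum_(0 <= j < l.+1) derivn_cc j f (lend hab) / j`!%:R * (x - a) ^+ j
    * reg_inc_beta r (l - j) (1 - xi x).

End Blending.

(* Main.v *)
Require Import Defs.
From HB Require Import structures.
From mathcomp Require Import all_boot all_order all_algebra.
From mathcomp Require Import all_classical all_reals all_analysis.

Import Order.TTheory GRing.Theory Num.Theory.
Import numFieldNormedType.Exports.

Local Open Scope ring_scope.

(** Everything in sight is a polynomial. Since [l] and [r] are integers, the
    regularized incomplete Beta function agrees for nonnegative arguments with
    a polynomial [beta_poly l r]: the antiderivative [B] of the weight
    [t ^ l * (1 - t) ^ r] that vanishes at 0, scaled so that [B 1 = 1]. Its
    derivative vanishes to order [l] at 0 and to order [r] at 1, so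
    [t ^ l.+1] divides [B] and [(t - 1) ^ r.+1] divides [1 - B]
    ([dvdp_beta_poly0], [dvdp_beta_poly1]).

    Let [L] be the affine coordinate taking the value 0 at the endpoint [u]
    where the blend must vanish and 1 at the endpoint [v] where it must match.
    In the sum of the terms [e k / k! * (x - v) ^ k * B_(l, r-k) (L x)], every
    term is divisible by [(x - u) ^ l.+1], so all derivatives up to order [l]
    vanish at [u]. Replacing [B_(l, r-k)] by 1 changes the [k]-th term by a
    multiple of [(x - v) ^ k * (x - v) ^ (r - k).+1 = (x - v) ^ r.+1], so at
    [v] the blend has the same derivatives up to order [r] as the Taylor
    polynomial with coefficients [e k / k!], namely the [e k]: the decrease
    of the second index of [B] is exactly compensated by the factor
    [(x - v) ^ k] ([derivn_blend_poly_start], [derivn_blend_poly_end]).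

    On the interval with its subspace topology, the derivatives of a
    polynomial function are the formal ones, also at the endpoints, so the
    blends belong to every [Cq]; linearity is that of the derivatives of the
    argument at [v], which exist up to order [r] because [r <= q]. Leftward
    and rightward blending are one construction, for the coordinates [xi] and
    [1 - xi]. *)

(** * Contact of polynomials at a point *)

Section PolynomialContact.
Context {F : numFieldType}.
Implicit Types (p q L : {poly F}) (c d : F) (n j k : nat).

Lemma dvdp_XsubC_deriv p c n :
  ('X - c%:P) ^+ n.+1 %| p -> ('X - c%:P) ^+ n %| p^`().
Proof.
case/dvdpP => s ->; rewrite derivM deriv_exp derivXsubC mul1r /=.
apply: dvdp_add; first by rewrite exprS mulrA dvdp_mulIr.
by rewrite mulrnAr -mulrnAl dvdp_mulIr.
Qed.

Lemma dvdp_XsubC_derivn p c n j : (j <= n)%N ->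
  ('X - c%:P) ^+ n.+1 %| p -> p^`(j).[c] = 0.
Proof.
elim: j n p => [|j IH] n p.
  move=> _.
  by move/(dvdp_trans (dvdp_exp2l _ (ltn0Sn n))); rewrite expr1 => /polyXsubCP.
by case: n => // n jn /dvdp_XsubC_deriv; rewrite derivSn; apply: IH.
Qed.

(** Differentiation lowers the multiplicity of a root by exactly one, because
    the characteristic is 0; hence a root of [p] has one more than its
    multiplicity in [p^`()]. *)
Lemma dvdp_XsubC_primitive p c n :
  p.[c] = 0 -> ('X - c%:P) ^+ n %| p^`() -> ('X - c%:P) ^+ n.+1 %| p.
Proof.
have [->|p0] := eqVneq p 0; first by rewrite dvdp0.
move=> pc; have [m [s]] := multiplicity_XsubC p c.
rewrite p0 /= => sc pE.
have m0 : (0 < m)%N.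
  case: m pE => // pE; move: sc.
  by rewrite /root -(mulr1 s) -(expr0 ('X - c%:P)) -pE pc eqxx.
rewrite {}pE -(prednK m0) in p0 pc *; move: m.-1 => {}m {m0} in p0 pc *.
(* Here p = s * (X - c)^(m+1) with s.[c] != 0; if m < n, then dividing p' by
   (X - c)^m leaves s' * (X - c) + (m+1) * s, which X - c must divide. *)
have Xc0 : ('X - c%:P : {poly F}) != 0 by rewrite polyXsubC_eq0.
have [nm _|mn] := leqP n m; first by rewrite dvdp_mull // dvdp_exp2l.
move/(dvdp_trans (dvdp_exp2l _ mn)); rewrite derivM deriv_exp derivXsubC mul1r /=.
rewrite mulrnAr -mulrnAl exprS mulrA -mulrDl.
rewrite dvdp_mul2r ?expf_neq0 // => /polyXsubCP.
rewrite hornerD hornerM hornerXsubC subrr mulr0 add0r hornerMn => /eqP.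
by rewrite mulrn_eq0 /=; move: sc; rewrite /root => /negPf ->.
Qed.

Lemma dvdp_XsubC_comp p L c d n : L.[d] = c ->
  ('X - c%:P) ^+ n %| p -> ('X - d%:P) ^+ n %| p \Po L.
Proof.
move=> Ld /(dvdp_comp_poly L); apply: dvdp_trans.
rewrite rmorphXn /= dvdp_exp2r //; apply/polyXsubCP.
by rewrite comp_polyB comp_polyX comp_polyC hornerD hornerN hornerC Ld subrr.
Qed.

Lemma derivn_XsubC_exp c k j :
  (('X - c%:P) ^+ k)^`(j) = ('X - c%:P) ^+ (k - j) *+ k ^_ j :> {poly F}.
Proof.
elim: j => [|j IH]; first by rewrite subn0.
rewrite derivnS IH derivMn deriv_exp derivXsubC mul1r -mulrnA -subnS.
by rewrite ffactnSr mulnC.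
Qed.

Definition taylor_poly n (e : nat -> F) c : {poly F} :=
  \sum_(0 <= k < n.+1) (e k / k`!%:R) *: ('X - c%:P) ^+ k.

Lemma derivn_taylor_poly n e c j : (j <= n)%N ->
  (taylor_poly n e c)^`(j).[c] = e j.
Proof.
move=> jn; rewrite /taylor_poly linear_sum horner_sum /=.
under eq_bigr => k _.
  rewrite derivnZ derivn_XsubC_exp hornerZ hornerMn horner_exp hornerXsubC subrr.
  over.
rewrite (bigD1_seq j) ?mem_index_iota ?iota_uniq //= big1_seq => [|k /andP[kj _]].
  rewrite subnn expr0 ffactnn addr0.
  by rewrite divfK // pnatr_eq0 -lt0n fact_gt0.
have [kj'|jk] := ltnP k j; first by rewrite ffact_small // mulr0n mulr0.
by rewrite expr0n subn_eq0 leqNgt ltn_neqAle eq_sym kj jk mul0rn mulr0.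
Qed.

(** The constant coefficient is [p`_0 / 0 = 0], which makes this the
    antiderivative vanishing at 0. *)
Definition primitive p : {poly F} := \poly_(i < (size p).+1) (p`_i.-1 / i%:R).

Lemma primitive_at0 p : (primitive p).[0] = 0.
Proof. by rewrite horner_coef0 coef_poly /= invr0 mulr0. Qed.

Lemma deriv_primitive p : (primitive p)^`() = p.
Proof.
apply/polyP => i; rewrite coef_deriv coef_poly ltnS /=.
case: ltnP => [_|/(nth_default 0) ->]; last by rewrite mul0rn.
by rewrite -(mulr_natr (_ / _)) divfK // pnatr_eq0.
Qed.

End PolynomialContact.

(** * The incomplete Beta function as a polynomial *)

Section BetaPolynomial.
Context {R : realType}.
Implicit Types (l r : nat) (x : R).

Lemma Rintegral_horner (p q : {poly R}) x : q^`() = p -> 0 <= x ->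
  \int[lebesgue_measure]_(t in `[0, x]) p.[t] = q.[x] - q.[0].
Proof.
move=> qp; rewrite le_eqVlt => /predU1P[<-|x0].
  by rewrite set_itv1 Rintegral_set1 subrr.
rewrite /Rintegral (@continuous_FTC2 _ _ (horner q)) //.
- by apply: continuous_subspaceT; exact: continuous_horner.
- split=> [y _||].
  + exact: derivable_horner.
  + by apply: cvg_at_right_filter; exact: continuous_horner.
  + by apply: cvg_at_left_filter; exact: continuous_horner.
- by move=> y _; rewrite -derivE qp.
Qed.

Definition beta_weight l r : {poly R} := 'X^l * (1 - 'X) ^+ r.

Definition beta_poly l r : {poly R} :=
  (primitive (beta_weight l r)).[1]^-1 *: primitive (beta_weight l r).

Lemma horner_beta_weight l r x : (beta_weight l r).[x] = x ^+ l * (1 - x) ^+ r.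
Proof.
by rewrite hornerM hornerXn horner_exp hornerD hornerN hornerX -[1]polyC1 hornerC.
Qed.

(** Otherwise the antiderivative takes the same value at 0 and 1, and by
    Rolle its derivative, the weight, has a zero strictly between them. *)
Lemma primitive_beta_weight_neq0 l r : (primitive (beta_weight l r)).[1] != 0.
Proof.
set q := primitive _; apply/eqP => q1.
have [|||c c01 qc] := @Rolle R (horner q) 0 1 ltr01.
- by move=> y _; exact: derivable_horner.
- by apply: continuous_subspaceT; exact: continuous_horner.
- by rewrite q1 primitive_at0.
have [_ q'c] := qc; have [_] := is_derive_poly q c.
rewrite {}q'c deriv_primitive horner_beta_weight => /esym/eqP.
move: c01; rewrite in_itv /= => /andP[c0 c1].
by rewrite mulf_eq0 !expf_eq0 subr_eq0 (gt_eqF c0) (gt_eqF c1) !andbF.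
Qed.

Lemma reg_inc_betaE l r x : 0 <= x ->
  reg_inc_beta l r x = (beta_poly l r).[x].
Proof.
move=> x0; rewrite /reg_inc_beta /beta_poly hornerZ mulrC.
have E y : 0 <= y ->
    \int[lebesgue_measure]_(t in `[0, y]) (t ^+ l * (1 - t) ^+ r) =
    (primitive (beta_weight l r)).[y].
  move=> y0; under eq_Rintegral do rewrite -horner_beta_weight.
  by rewrite (Rintegral_horner _ _ _ (deriv_primitive _) y0) primitive_at0 subr0.
by rewrite !E.
Qed.

Lemma dvdp_beta_poly0 l r : ('X - 0%:P) ^+ l.+1 %| beta_poly l r.
Proof.
apply: dvdp_XsubC_primitive; first by rewrite hornerZ primitive_at0 mulr0.
by rewrite derivZ deriv_primitive scalerAr polyC0 subr0 dvdp_mulIl.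
Qed.

Lemma dvdp_beta_poly1 l r : ('X - 1%:P) ^+ r.+1 %| 1 - beta_poly l r.
Proof.
apply: dvdp_XsubC_primitive.
  rewrite hornerD hornerN hornerZ mulVf ?primitive_beta_weight_neq0 //.
  by rewrite -[1]polyC1 hornerC subrr.
rewrite derivB -polyC1 derivC sub0r dvdpNr derivZ deriv_primitive scalerAl.
apply: dvdp_mull; apply: dvdp_exp2r; apply/polyXsubCP.
by rewrite !hornerE subrr.
Qed.

End BetaPolynomial.

(** * Blending polynomials *)

Section BlendPolynomial.
Context {R : realType}.
Implicit Types (l r : nat) (e : nat -> R) (u v : R) (L : {poly R}).

(** The numbers [e k] are the derivatives prescribed at [v]. *)
Definition blend_poly l r e v L : {poly R} :=
  \sum_(0 <= k < r.+1)
    (e k / k`!%:R) *: ('X - v%:P) ^+ k * (beta_poly l (r - k) \Po L).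

Lemma blend_poly_lin l r (c : R) e e' v L :
  blend_poly l r (fun k => c * e k + e' k) v L =
  c *: blend_poly l r e v L + blend_poly l r e' v L.
Proof.
rewrite /blend_poly scaler_sumr -big_split /=; apply: eq_bigr => k _.
by rewrite mulrDl -mulrA scalerDl mulrDl -scalerA scalerAl.
Qed.

Lemma eq_blend_poly l r e e' v L : (forall k, (k <= r)%N -> e k = e' k) ->
  blend_poly l r e v L = blend_poly l r e' v L.
Proof. by move=> ee'; apply: eq_big_nat => k; rewrite ltnS => /ee' ->. Qed.

Lemma derivn_blend_poly_start l r e u v L j : (j <= l)%N -> L.[u] = 0 ->
  (blend_poly l r e v L)^`(j).[u] = 0.
Proof.
move=> jl Lu; apply: (dvdp_XsubC_derivn _ _ _ _ jl); rewrite /blend_poly.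
elim/big_rec: _ => [|k p _ dvd_p]; first exact: dvdp0.
by rewrite dvdp_add // dvdp_mull // (dvdp_XsubC_comp _ _ _ _ _ Lu) // dvdp_beta_poly0.
Qed.

(** The difference with the Taylor polynomial at [v] is divisible by
    [('X - v%:P) ^+ r.+1]. *)
Lemma derivn_blend_poly_end l r e v L k : (k <= r)%N -> L.[v] = 1 ->
  (blend_poly l r e v L)^`(k).[v] = e k.
Proof.
move=> kr Lv; rewrite -[RHS](derivn_taylor_poly _ e v _ kr); apply/eqP.
rewrite eq_sym -subr_eq0 -hornerN -hornerD -derivnB; apply/eqP.
apply: (dvdp_XsubC_derivn _ _ _ _ kr).
rewrite /taylor_poly /blend_poly -sumrB big_nat.
elim/big_rec: _ => [|i p /andP[_ ir] dvd_p]; first exact: dvdp0.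
rewrite dvdp_add //.
rewrite -{1}(mulr1 (_ *: _)) -mulrBr -scalerAl scalerAr.
(* ('X - v)^(r+1) splits as ('X - v)^i, present in the i-th term, times
   ('X - v)^(r-i+1), which divides 1 - B_(l, r-i) composed with L. *)
rewrite ltnS in ir; rewrite -{1}(subnKC ir) -addnS exprD dvdp_mul //.
rewrite -mul_polyC dvdp_mull //.
have -> : 1 - (beta_poly l (r - i) \Po L) = (1 - beta_poly l (r - i)) \Po L.
  by rewrite comp_polyB -polyC1 comp_polyC.
by rewrite (dvdp_XsubC_comp _ _ _ _ _ Lv) // dvdp_beta_poly1.
Qed.

End BlendPolynomial.

(** * Polynomial functions on a compact interval *)

Section PolynomialFunctions.
Context {R : realType} {a b : R} (hab : a < b).
Implicit Types (p : {poly R}).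

Definition poly_cc p : itvcc a b -> R := fun x => p.[\val x].

Lemma continuous_poly_cc p : continuous (poly_cc p).
Proof.
move=> x; apply: (@continuous_comp (itvcc a b) R R (fun y => \val y) (horner p) x).
  exact: (@initial_continuous _ _ set_val).
exact: continuous_horner.
Qed.

(** Away from [x], the slope is the value of the quotient [s] of [p - p.[x]]
    by ['X - x], a polynomial with [s.[x] = p^`().[x]]. So the limit is that of
    a continuous function, and endpoints need no separate treatment. *)
Lemma cvg_slope_poly_cc p (x : itvcc a b) :
  (slope (poly_cc p) x y @[y --> x^'] --> p^`().[\val x])%classic.
Proof.
have /polyXsubCP/dvdpP[s sE] : (p - p.[\val x]%:P).[\val x] = 0.
  by rewrite hornerD hornerN hornerC subrr.
have -> : p^`().[\val x] = poly_cc s x.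
  have -> : p = s * ('X - (\val x)%:P) + p.[\val x]%:P by rewrite -sE subrK.
  rewrite derivD derivC addr0 derivM derivXsubC mulr1 hornerD hornerM.
  by rewrite hornerXsubC subrr mulr0 add0r.
suff slopeE : {near (x^')%classic, poly_cc s =1 slope (poly_cc p) x}.
  apply: cvg_trans (near_eq_cvg slopeE) _.
  exact: cvg_within_filter (continuous_poly_cc s x).
apply: filterS (withinT _ _) => y /= yx.
rewrite /slope /poly_cc.
have := congr1 (horner^~ (\val y)) sE.
rewrite hornerD hornerN hornerC hornerM hornerXsubC => ->.
by rewrite mulfK // subr_eq0 (inj_eq val_inj).
Qed.

Lemma deriv_poly_cc p : deriv_cc (poly_cc p) = poly_cc p^`().
Proof.
apply/funext => x; have xP := dnbhs_cc_proper hab x.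
by apply: cvg_lim => //; exact: cvg_slope_poly_cc.
Qed.

Lemma derivn_poly_cc k p : derivn_cc k (poly_cc p) = poly_cc p^`(k).
Proof.
by elim: k => // k IH; rewrite derivnS -deriv_poly_cc -IH.
Qed.

Lemma continuously_differentiable_poly_cc q p :
  continuously_differentiable q (poly_cc p).
Proof.
split=> k _; rewrite derivn_poly_cc; last exact: continuous_poly_cc.
by move=> x; apply/cvg_ex; eexists; exact: cvg_slope_poly_cc.
Qed.

Lemma derivn_cc_lin (q : option nat) (c : R) (f g : itvcc a b -> R) k :
  continuously_differentiable q f -> continuously_differentiable q g ->
  leq_ext k q -> derivn_cc k (c *: f + g) = c *: derivn_cc k f + derivn_cc k g.
Proof.
move=> [df _] [dg _]; elim: k => // k IH kq.
have kq' : leq_ext k q by case: q kq {df dg IH} => //= n /ltnW.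
have derivnS_cc h : derivn_cc k.+1 h = deriv_cc (derivn_cc k h) by [].
rewrite !derivnS_cc IH // deriv_cc_lin //.
- exact: df.
- exact: dg.
Qed.

Lemma Cq_continuously_differentiable q (f : Cq hab q) :
  continuously_differentiable q f.
Proof. by case: f => f /= /asboolP. Qed.

End PolynomialFunctions.

(** * Blending operators *)

Section BlendOperator.
Context {R : realType} {a b : R} (hab : a < b) (q : option nat) (l r : nat).
Context (hr : leq_ext r q) (w : itvcc a b) (L : {poly R}).

Lemma poly_cc_Cq (p : {poly R}) : poly_cc p \in Cq_pred (a := a) (b := b) q hab.
Proof. exact/asboolP/continuously_differentiable_poly_cc. Qed.

(** The inequality [r <= q] is what makes the operator linear; as an argument
    it lets the linear structure be inferred. *)
Definition blend_op of leq_ext r q := fun g : Cq hab q =>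
  MkCq (poly_cc_Cq (blend_poly l r (fun k => derivn_cc k g w) (\val w) L)).

(** Only derivatives of order at most [r <= q] enter, and these are linear on
    [Cq hab q]. *)
Lemma blend_op_is_linear : linear (blend_op hr).
Proof.
move=> c f g; apply/val_inj/funext => x /=.
rewrite (eq_blend_poly l r _ (fun k => c * derivn_cc k f w + derivn_cc k g w)).
  by rewrite blend_poly_lin /poly_cc hornerD hornerZ.
move=> k kr; have kq : leq_ext k q by case: (q) hr => //= n; exact: leq_trans.
by rewrite (derivn_cc_lin hab q) //; exact: Cq_continuously_differentiable.
Qed.

HB.instance Definition _ := GRing.isLinear.Build _ _ _ _ _ blend_op_is_linear.

Lemma blend_op_start (u : itvcc a b) g j : (j <= l)%N -> L.[\val u] = 0 ->
  derivn_cc j (blend_op hr g) u = 0.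
Proof.
move=> jl Lu; rewrite [Cq_val _]/= derivn_poly_cc //.
exact: derivn_blend_poly_start.
Qed.

Lemma blend_op_end g k : (k <= r)%N -> L.[\val w] = 1 ->
  derivn_cc k (blend_op hr g) w = derivn_cc k g w.
Proof.
move=> kr Lw; rewrite [Cq_val _]/= derivn_poly_cc //.
exact: (derivn_blend_poly_end _ _ _ _ _ _ kr Lw).
Qed.

Lemma blend_opE g x : 0 <= L.[\val x] -> blend_op hr g x =
  \sum_(0 <= k < r.+1) derivn_cc k g w / k`!%:R * (\val x - \val w) ^+ k
    * reg_inc_beta l (r - k) L.[\val x].
Proof.
move=> Lx; rewrite /= /poly_cc /blend_poly horner_sum; apply: eq_bigr => k _.
by rewrite hornerM hornerZ horner_exp hornerXsubC horner_comp reg_inc_betaE.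
Qed.

End BlendOperator.

Section UnitCoordinate.
Context {R : realType} {a b : R} (hab : a < b).

Definition xi_poly : {poly R} := (b - a)^-1 *: ('X - a%:P).

Lemma xi_polyE x : xi_poly.[x] = @xi R a b x.
Proof. by rewrite hornerZ hornerXsubC mulrC. Qed.

Lemma xi_lend : @xi R a b a = 0.
Proof. by rewrite /xi subrr mul0r. Qed.

Lemma xi_rend : @xi R a b b = 1.
Proof. by rewrite /xi divff // subr_eq0 gt_eqF. Qed.

Lemma xi_itv (x : itvcc a b) : 0 <= @xi R a b (\val x) <= 1.
Proof.
have := set_valP x; rewrite /= in_itv /= => /andP[ax xb].
rewrite /xi divr_ge0 ?subr_ge0 ?(ltW hab) //=.
by rewrite ler_pdivrMr ?subr_gt0 // mul1r lerD2r.
Qed.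

Lemma rev_xi_polyE x : (1 - xi_poly).[x] = 1 - @xi R a b x.
Proof. by rewrite hornerD hornerN xi_polyE -[1]polyC1 hornerC. Qed.

End UnitCoordinate.

Theorem corollary2 (R : realType) (a0 b0 : R) (hab : a0 < b0)
    (l r : nat) (q : option nat) (hl : leq_ext l q) (hr : leq_ext r q) :
  (exists BL : {linear Cq hab q -> Cq hab q},
     (forall (g : Cq hab q) (x : itvcc a0 b0),
        BL g x = blendL hab l r g (\val x)) /\
     leftward_blend l r BL) /\
  (exists BR : {linear Cq hab q -> Cq hab q},
     (forall (f : Cq hab q) (x : itvcc a0 b0),
        BR f x = blendR hab l r f (\val x)) /\
     rightward_blend l r BR).
Proof.
split.
- exists (blend_op hab q l r (rend hab) (@xi_poly R a0 b0) hr).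
  split=> [g x|].
    rewrite blend_opE xi_polyE //.
    by have /andP[] := xi_itv hab x.
  split=> // g; split=> j jn.
  + by apply: blend_op_start => //; rewrite xi_polyE xi_lend.
  + by apply: blend_op_end => //; rewrite xi_polyE xi_rend.
- exists (blend_op hab q r l (lend hab) (1 - @xi_poly R a0 b0) hl).
  split=> [f x|].
    rewrite blend_opE rev_xi_polyE //.
    by rewrite subr_ge0; have /andP[] := xi_itv hab x.
  split=> // f; split=> j jn.
  + by apply: blend_op_end => //; rewrite rev_xi_polyE xi_lend subr0.
  + by apply: blend_op_start => //; rewrite rev_xi_polyE xi_rend ?subrr.
Qed.
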